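(* Let $B,C$ be $2\times 2$ generic commuting matrices over $\mathbb{Q}$, let $K$ be the field generated over $\mathbb{Q}$ by all their entries, $\overline{K}$ its algebraic closure, and let $L=K(\sigma(B),\sigma(C))$ be the extension of $K$ generated by the eigenvalues of $B$ and of $C$. Consider the equation $$X^2+BXB+C=0_2$$ in the unknown $2\times 2$ matrix $X$. There are four (trivial) isolated solutions, in $\mathcal{M}_2(\overline{K})$, that commute with $B$ and $C$. Moreover there are infinitely many solutions $X\in\mathcal{M}_2(L(u))$ that depend on a parameter $u$; these solutions do not commute with $B,C$.
   Context: Generic commuting matrices: let $B=[b_{i,j}],C=[c_{i,j}]\in\mathcal{M}_2(F)$, where $F$ is a transcendental extension of $\mathbb{Q}$. Let $\mathcal{I}$ be the ideal over $\mathbb{Q}$ (in the polynomial ring over $\mathbb{Q}$ in the $8$ entries of $2\times 2$ matrices of indeterminates $U_0,U_1$) generated by the commutativity relations $U_0U_1=U_1U_0$. $B,C$ are generic commuting matrices over $\mathbb{Q}$ if $BC=CB$ and, for every polynomial $P\notin\mathcal{I}$ over $\mathbb{Q}$, $P(\{b_{i,j}\},\{c_{i,j}\})\ne 0$. $\sigma(M)$ denotes the spectrum of $M$. A solution is isolated if some neighborhood of it contains no other solution. *)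

(* Defs.v *)
From HB Require Import structures.
From mathcomp Require Import all_boot all_order all_algebra.
From mathcomp Require Import boolp classical_sets functions cardinality.
From mathcomp Require Import mpoly.

Set Implicit Arguments.
Unset Strict Implicit.
Unset Printing Implicit Defensive.

Import GRing.Theory.
Local Open Scope classical_set_scope.
Local Open Scope ring_scope.

(* An extension F of k is given by a field morphism f : k -> F; for k = rat,
   such an f exists exactly when F has characteristic 0, and is then unique. *)
Definition transcendental_ext (k F : fieldType) (f : {rmorphism k -> F}) :=
  exists t : F, ~ algebraicOver f t.

Section GenericCommuting.
Variable n : nat.

(* The entries of U_0 are the first n * n indeterminates, those of U_1 the
   last n * n, both in the row-major order of mxvec. *)
Definition indet_mx0 : 'M[{mpoly rat[n * n + n * n]}]_n :=
  \matrix_(i, j) 'X_(lshift (n * n) (mxvec_index i j)).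

Definition indet_mx1 : 'M[{mpoly rat[n * n + n * n]}]_n :=
  \matrix_(i, j) 'X_(rshift (n * n) (mxvec_index i j)).

Definition commutation_ideal : set {mpoly rat[n * n + n * n]} :=
  [set P | exists Q : 'M[{mpoly rat[n * n + n * n]}]_n,
    P = \sum_i \sum_j
          Q i j * (indet_mx0 *m indet_mx1 - indet_mx1 *m indet_mx0) i j].

Definition eval_pair (F : fieldType) (iota : {rmorphism rat -> F})
    (B C : 'M[F]_n) (P : {mpoly rat[n * n + n * n]}) : F :=
  (map_mpoly iota P).@[row_mx (mxvec B) (mxvec C) 0].

Definition generic_commuting (F : fieldType) (iota : {rmorphism rat -> F})
    (B C : 'M[F]_n) :=
  comm_mx B C /\
  forall P, ~ commutation_ideal P -> eval_pair iota B C P != 0.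

End GenericCommuting.

Section Adjoin.
Variables (k E : fieldType) (f : {rmorphism k -> E}) (S : set E).

Definition adjoin_pred : {pred E} := fun x =>
  `[< forall V : {pred E}, divring_closed V ->
        (forall a, f a \in V) -> (forall s, S s -> s \in V) -> x \in V >].

Fact adjoin_divring_closed : divring_closed adjoin_pred.
Proof.
split.
- by apply/asboolP => V [].
- move=> x y /asboolP hx /asboolP hy; apply/asboolP => V cV fV SV.
  by case: (cV) => _ VB _; apply: VB; [apply: hx | apply: hy].
- move=> x y /asboolP hx /asboolP hy; apply/asboolP => V cV fV SV.
  by case: (cV) => _ _ VD; apply: VD; [apply: hx | apply: hy].
Qed.

HB.instance Definition _ :=
  GRing.isDivringClosed.Build E adjoin_pred adjoin_divring_closed.

(* The field k(S), as a subfield of E. *)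
Record adjoin := Adjoin { adjoin_val :> E; _ : adjoin_val \in adjoin_pred }.

HB.instance Definition _ := [isSub for adjoin_val].
HB.instance Definition _ := [Choice of adjoin by <:].
HB.instance Definition _ := [SubChoice_isSubIntegralDomain of adjoin by <:].
HB.instance Definition _ := [SubIntegralDomain_isSubField of adjoin by <:].

Fact adjoin_base_subproof a : f a \in adjoin_pred.
Proof. by apply/asboolP => V _ fV _; apply: fV. Qed.

Fact adjoin_gen_subproof x : S x -> x \in adjoin_pred.
Proof. by move=> Sx; apply/asboolP => V _ _ SV; apply: SV. Qed.

Definition adjoin_base (a : k) : adjoin := Adjoin (adjoin_base_subproof a).

Definition adjoin_gen x (Sx : S x) : adjoin := Adjoin (adjoin_gen_subproof Sx).

Fact adjoin_base_is_zmod_morphism : zmod_morphism adjoin_base.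
Proof. by move=> x y; apply: val_inj; rewrite /= !rmorphB. Qed.

Fact adjoin_base_is_monoid_morphism : monoid_morphism adjoin_base.
Proof.
by split=> [|x y]; apply: val_inj; rewrite /= ?rmorph1 ?rmorphM.
Qed.

HB.instance Definition _ :=
  GRing.isZmodMorphism.Build k adjoin adjoin_base adjoin_base_is_zmod_morphism.
HB.instance Definition _ :=
  GRing.isMonoidMorphism.Build k adjoin adjoin_base
    adjoin_base_is_monoid_morphism.

End Adjoin.

Section EntryField.
Variables (k F : fieldType) (f : {rmorphism k -> F}) (n : nat).
Variables B C : 'M[F]_n.

Definition entries : set F :=
  [set x | exists i j, x = B i j \/ x = C i j].

Definition entry_field : fieldType := adjoin f entries.

Fact entriesl i j : entries (B i j).
Proof. by exists i, j; left. Qed.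

Fact entriesr i j : entries (C i j).
Proof. by exists i, j; right. Qed.

(* B and C themselves, with their entries retyped in the field they generate. *)
Definition entry_mxl : 'M[entry_field]_n :=
  \matrix_(i, j) adjoin_gen f (entriesl i j).

Definition entry_mxr : 'M[entry_field]_n :=
  \matrix_(i, j) adjoin_gen f (entriesr i j).

Fact entry_mxlE : map_mx val entry_mxl = B.
Proof. by apply/matrixP => i j; rewrite !mxE. Qed.

Fact entry_mxrE : map_mx val entry_mxr = C.
Proof. by apply/matrixP => i j; rewrite !mxE. Qed.

End EntryField.

Definition is_algebraic_closure (K : fieldType) (Kbar : closedFieldType)
    (j : {rmorphism K -> Kbar}) := forall z : Kbar, algebraicOver j z.

Definition spectra (K : fieldType) (Kbar : closedFieldType)
    (j : {rmorphism K -> Kbar}) (n : nat) (B C : 'M[K]_n) : set Kbar :=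
  [set z | eigenvalue (map_mx j B) z \/ eigenvalue (map_mx j C) z].

Definition spectral_field (K : fieldType) (Kbar : closedFieldType)
    (j : {rmorphism K -> Kbar}) (n : nat) (B C : 'M[K]_n) : fieldType :=
  adjoin j (spectra j B C).

Definition ratfun (L : fieldType) : fieldType := {fraction {poly L}}.

Definition ratfun_const (L : fieldType) : L -> ratfun L := fun a => tofrac a%:P.

Definition depends_on_param (L : fieldType) (n : nat)
    (X : 'M[ratfun L]_n) :=
  ~ exists Y : 'M[L]_n, X = map_mx (@ratfun_const L) Y.

Definition solutions (R : fieldType) (B C : 'M[R]_2) : set 'M[R]_2 :=
  [set X | X ^+ 2 + B * X * B + C = 0].

(* An abstract algebraic closure carries no metric, so neighborhoods are those
   of the Zariski topology on the affine space of matrices.  If the field is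
   embedded in the complex numbers, every Zariski neighborhood is also one for
   the usual topology, so a point isolated in this sense is also isolated in
   the usual sense. *)
Section Zariski.
Variables (k : fieldType) (n : nat).

Definition zariski_closed (Z : set 'M[k]_n) :=
  exists P : set {mpoly k[n * n]},
    Z = [set X | forall p, P p -> p.@[mxvec X 0] = 0].

Definition zariski_nbhs (X : 'M[k]_n) (N : set 'M[k]_n) :=
  exists U : set 'M[k]_n, [/\ zariski_closed (~` U), U X & U `<=` N].

Definition isolated (A : set 'M[k]_n) (X : 'M[k]_n) :=
  A X /\ exists2 N, zariski_nbhs X N & N `&` A = [set X].

End Zariski.

(* Main.v *)
(* Since [B] has distinct eigenvalues, [B] and [C] become simultaneously
   diagonal, say [diag(b1, b2)] and [diag(c1, c2)], over any field containing
   the eigenvalues of [B].  In an eigenbasis the equation for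
   [X = [[x, y], [z, w]]] reads
     [x^2 + y z + b1^2 x + c1 = 0],  [y (x + w + b1 b2) = 0],
     [w^2 + y z + b2^2 w + c2 = 0],  [z (x + w + b1 b2) = 0].
   The solutions commuting with [B] are those with [y = z = 0]: two choices for
   [x] and two for [w].  At such a solution [tr X + det B = x + w + b1 b2] is
   nonzero, which forces nearby solutions to be diagonal too.  The other
   solutions have [x + w + b1 b2 = 0], which determines [x], [w] and [y z], and
   leaves [y] as a free parameter.  A solution over [L(u)] that commutes with
   [B] or [C] does not depend on [u], because a root in [L(u)] of a monic
   quadratic over [L] lies in [L].  All the inequalities needed say that one
   polynomial in the entries of [B] and [C] does not vanish; by genericity it
   suffices that it does not vanish at one pair of commuting rational
   matrices. *)
From HB Require Import structures.
Require Import Defs.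
From mathcomp Require Import all_boot all_order all_algebra.
From mathcomp Require Import boolp classical_sets functions cardinality.
From mathcomp Require Import mpoly ring generic_quotient.
Set Implicit Arguments.
Unset Strict Implicit.
Unset Printing Implicit Defensive.
Import GRing.Theory.
Local Open Scope classical_set_scope.
Local Open Scope card_scope.
Local Open Scope ring_scope.

(** * Entrywise calculus of 2 by 2 matrices and the polynomial whose nonvanishing is needed *)

Section TwoByTwo.
Variable R : comNzRingType.

Definition mat2 (a b c d : R) : 'M[R]_2 :=
  \matrix_(i, j) if i == 0 then if j == 0 then a else b
                 else if j == 0 then c else d.

Lemma mat2_eta (X : 'M[R]_2) : X = mat2 (X 0 0) (X 0 1) (X 1 0) (X 1 1).
Proof.
have ord2 (i : 'I_2) : i = 0 \/ i = 1.
  by case: i => [[|[|//]] p]; [left | right]; apply: val_inj.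
apply/matrixP => i j; rewrite mxE.
by case: (ord2 i) (ord2 j) => -> [] ->.
Qed.

Lemma mat2_inj a b c d a' b' c' d' : mat2 a b c d = mat2 a' b' c' d' ->
  [/\ a = a', b = b', c = c' & d = d'].
Proof.
move=> /matrixP e.
by move: (e 0 0) (e 0 1) (e 1 0) (e 1 1); rewrite !mxE.
Qed.

Lemma mat2D a b c d a' b' c' d' :
  mat2 a b c d + mat2 a' b' c' d' = mat2 (a + a') (b + b') (c + c') (d + d').
Proof. by rewrite [LHS]mat2_eta !mxE. Qed.

Lemma mat2N a b c d : - mat2 a b c d = mat2 (- a) (- b) (- c) (- d).
Proof. by rewrite [LHS]mat2_eta !mxE. Qed.

Lemma mat2Mn a b c d n :
  mat2 a b c d *+ n = mat2 (a *+ n) (b *+ n) (c *+ n) (d *+ n).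
Proof.
by elim: n => [|n IH]; rewrite ?mulrS ?IH ?mat2D // [LHS]mat2_eta !mxE.
Qed.

Lemma mat2M a b c d a' b' c' d' :
  mat2 a b c d * mat2 a' b' c' d' =
  mat2 (a * a' + b * c') (a * b' + b * d') (c * a' + d * c') (c * b' + d * d').
Proof.
rewrite [LHS]mat2_eta.
by congr mat2; rewrite !mxE !big_ord_recl big_ord0 /= !mxE addr0.
Qed.

Lemma scalar_mat2 a : a%:M = mat2 a 0 0 a.
Proof. by rewrite [LHS]mat2_eta !mxE. Qed.

Lemma mat2_0 : 0 = mat2 0 0 0 0.
Proof. by rewrite [LHS]mat2_eta !mxE. Qed.

Lemma tr_mat2 a b c d : \tr (mat2 a b c d) = a + d.
Proof. by rewrite /mxtrace !big_ord_recl big_ord0 !mxE addr0. Qed.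

Lemma det_mat2 a b c d : \det (mat2 a b c d) = a * d - b * c.
Proof.
rewrite (expand_det_row _ 0) !big_ord_recl big_ord0 /cofactor !det_mx11 !mxE /=.
by rewrite addr0 expr0 expr1 mul1r mulN1r mulrN.
Qed.

Definition mat2E :=
  (mat2D, mat2N, mat2Mn, mat2M, scalar_mat2, tr_mat2, det_mat2).

Definition discr (A : 'M[R]_2) : R := \tr A ^+ 2 - \det A *+ 4.

(* On a simultaneous eigenvector of [B] and [C] with eigenvalues [b1] and [c1],
   where [b2] and [c2] are the other eigenvalues, the value of [shift B C] is
   [(b1 - b2)^2 x] for the only [x] such that
   [x^2 + b1^2 x + c1 = w^2 + b2^2 w + c2] with [x + w + b1 b2 = 0], and that of
   [resultant B C] is [(b1 - b2)^4 (x^2 + b1^2 x + c1)]. *)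
Definition shift (B C : 'M[R]_2) : 'M[R]_2 :=
  (\det B)%:M * ((\tr B)%:M - B) * (B *+ 2 - (\tr B)%:M) -
  (C *+ 2 - (\tr C)%:M).

Definition resultant (B C : 'M[R]_2) : 'M[R]_2 :=
  shift B C ^+ 2 + (discr B)%:M * B ^+ 2 * shift B C + (discr B)%:M ^+ 2 * C.

(** Nonvanishing of the factors gives, in order: eigenvectors of [B] of the shape used in
    [diagonalize], distinct eigenvalues of [B], distinct eigenvalues of [C], nonzero discriminants
    [b_i^4 - 4 c_i] of the two diagonal quadratics, and [tr X + det B] nonzero at commuting
    solutions. *)
Definition degeneracy (B C : 'M[R]_2) : R :=
  B 0 1 * discr B * discr C * \det (B ^+ 4 - C *+ 4) * \det (resultant B C).

End TwoByTwo.

(** * Compatibility with ring morphisms *)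

Section Naturality.
Variables (R S : comNzRingType) (f : {rmorphism R -> S}).

Lemma map_mat2 a b c d :
  map_mx f (mat2 a b c d) = mat2 (f a) (f b) (f c) (f d).
Proof. by rewrite [LHS]mat2_eta !mxE. Qed.

Lemma discr_map A : discr (map_mx f A) = f (discr A).
Proof. by rewrite /discr trace_map_mx det_map_mx rmorphB rmorphXn rmorphMn. Qed.

Lemma shift_map B C : shift (map_mx f B) (map_mx f C) = map_mx f (shift B C).
Proof.
rewrite /shift !(trace_map_mx, det_map_mx) !(rmorphB, rmorphM) /=.
by rewrite !(rmorphB, rmorphMn) /= !map_scalar_mx.
Qed.

Lemma resultant_map B C :
  resultant (map_mx f B) (map_mx f C) = map_mx f (resultant B C).
Proof.
rewrite /resultant shift_map discr_map; move: (shift B C) (discr B) => D d.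
by rewrite !expr2 2!rmorphD /= !rmorphM /= !map_scalar_mx.
Qed.

Lemma degeneracy_map B C :
  degeneracy (map_mx f B) (map_mx f C) = f (degeneracy B C).
Proof.
rewrite /degeneracy resultant_map !discr_map.
rewrite -!rmorphXn -!rmorphMn -!rmorphB /= !det_map_mx !rmorphM /=.
by rewrite mxE.
Qed.

End Naturality.

(** * Conjugation by an invertible matrix *)

Section Similarity.
Variables (F : fieldType) (P : 'M[F]_2) (uP : P \is a GRing.unit).

(** The proof of invertibility is an argument so that conjugation can be declared a ring
    morphism. *)
Definition simil of P \is a GRing.unit := fun X : 'M[F]_2 => P * X / P.

Fact simil_is_zmod_morphism : zmod_morphism (simil uP).
Proof. by move=> X Y; rewrite /simil mulrBr mulrBl. Qed.

Fact simil_is_monoid_morphism : monoid_morphism (simil uP).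
Proof.
by split=> [|X Y]; rewrite /simil ?mulr1 ?divrr // !mulrA divrK.
Qed.

HB.instance Definition _ := GRing.isZmodMorphism.Build 'M[F]_2 'M[F]_2
  (simil uP) simil_is_zmod_morphism.
HB.instance Definition _ := GRing.isMonoidMorphism.Build 'M[F]_2 'M[F]_2
  (simil uP) simil_is_monoid_morphism.

Lemma simil_scalar a : simil uP a%:M = a%:M.
Proof. by rewrite /simil [P * _]scalar_mxC mulrK. Qed.

Lemma simil_tr X : \tr (simil uP X) = \tr X.
Proof. by rewrite /simil mxtrace_mulC [_ *m _]mulKr. Qed.

Lemma simil_det X : \det (simil uP X) = \det X.
Proof.
by rewrite /simil !detM mulrAC -detM divrr // det1 mul1r.
Qed.

Lemma simil_inj : injective (simil uP).
Proof. by move=> X Y /(divIr uP)/(mulrI uP). Qed.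

Lemma simil_surj Y : exists X, simil uP X = Y.
Proof.
by exists (P^-1 * Y * P); rewrite /simil !mulrA mulrK // divrr ?mul1r.
Qed.

Lemma simil_comm X Y : comm_mx (simil uP X) (simil uP Y) <-> comm_mx X Y.
Proof.
rewrite /comm_mx !mulmxE -!rmorphM.
by split=> [/simil_inj|->].
Qed.

Lemma simil_solutions B C X :
  solutions (simil uP B) (simil uP C) (simil uP X) <-> solutions B C X.
Proof.
rewrite /solutions /= -rmorphXn -!rmorphM -!rmorphD.
rewrite -[X in _ = X](rmorph0 (simil uP)).
by split=> [/simil_inj|->].
Qed.

Lemma simil_discr X : discr (simil uP X) = discr X.
Proof. by rewrite /discr simil_tr simil_det. Qed.

Lemma simil_shift B C : shift (simil uP B) (simil uP C) = simil uP (shift B C).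
Proof.
rewrite /shift !(simil_tr, simil_det) !(rmorphB, rmorphM) /=.
by rewrite !(rmorphB, rmorphMn) /= !simil_scalar.
Qed.

Lemma simil_resultant B C :
  resultant (simil uP B) (simil uP C) = simil uP (resultant B C).
Proof.
rewrite /resultant simil_shift simil_discr; move: (shift B C) (discr B) => D d.
by rewrite !expr2 2!rmorphD /= !rmorphM /= !simil_scalar.
Qed.

End Similarity.

(** * The equation in a common eigenbasis *)

Section Diagonal.
Variable F : fieldType.
Implicit Types (X : 'M[F]_2) (a b c x y z w : F).

Lemma diag_solutions b1 b2 c1 c2 x y z w :
  solutions (mat2 b1 0 0 b2) (mat2 c1 0 0 c2) (mat2 x y z w) <->
  [/\ x ^+ 2 + y * z + b1 ^+ 2 * x + c1 = 0,
      y * (x + w + b1 * b2) = 0,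
      z * (x + w + b1 * b2) = 0 &
      w ^+ 2 + y * z + b2 ^+ 2 * w + c2 = 0].
Proof.
rewrite /solutions /= expr2 !mat2E mat2_0.
split=> [/mat2_inj[e1 e2 e3 e4]|[e1 e2 e3 e4]].
  by split; [rewrite -[RHS]e1 | rewrite -[RHS]e2 |
             rewrite -[RHS]e3 | rewrite -[RHS]e4]; ring.
by congr mat2; [rewrite -[RHS]e1 | rewrite -[RHS]e2 |
                rewrite -[RHS]e3 | rewrite -[RHS]e4]; ring.
Qed.

Lemma diag_comm b1 b2 x y z w : b1 != b2 ->
  comm_mx (mat2 x y z w) (mat2 b1 0 0 b2) <-> y = 0 /\ z = 0.
Proof.
move=> nb; rewrite /comm_mx mulmxE !mat2E.
split=> [/mat2_inj[_ e1 e2 _]|[-> ->]].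
  split; apply: (mulIf (x := b1 - b2)); rewrite ?subr_eq0 // mul0r mulrBr.
    apply/eqP; rewrite subr_eq0 (mulrC y b1); move: e1.
    by rewrite !(mulr0, mul0r, addr0, add0r) => ->.
  apply/eqP; rewrite subr_eq0 (mulrC z b2); move: e2.
  by rewrite !(mulr0, mul0r, addr0, add0r) => ->.
by congr mat2; ring.
Qed.

Lemma diag_discr a b : discr (mat2 a 0 0 b) = (a - b) ^+ 2.
Proof. by rewrite /discr !mat2E; ring. Qed.

Lemma diag_shift b1 b2 c1 c2 :
  shift (mat2 b1 0 0 b2) (mat2 c1 0 0 c2) =
  mat2 (b1 * b2 ^+ 2 * (b1 - b2) - (c1 - c2)) 0
       0 (b2 * b1 ^+ 2 * (b2 - b1) - (c2 - c1)).
Proof. by rewrite /shift !mat2E; congr mat2; ring. Qed.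

Lemma diag_resultant b1 b2 c1 c2 x :
  (b1 - b2) ^+ 2 * x = b1 * b2 ^+ 2 * (b1 - b2) - (c1 - c2) ->
  resultant (mat2 b1 0 0 b2) (mat2 c1 0 0 c2) 0 0 =
  (b1 - b2) ^+ 4 * (x ^+ 2 + b1 ^+ 2 * x + c1).
Proof.
move=> ex; rewrite /resultant diag_shift diag_discr -ex !expr2 !mat2E.
by rewrite mxE /=; ring.
Qed.

(** Every factor except [B 0 1] is invariant under conjugation. *)
Lemma degeneracy_simil P (uP : P \is a GRing.unit) (B C : 'M[F]_2) :
  degeneracy B C =
  B 0 1 * discr (simil uP B) * discr (simil uP C) *
  \det (simil uP B ^+ 4 - simil uP C *+ 4) *
  \det (resultant (simil uP B) (simil uP C)).
Proof.
rewrite simil_resultant -rmorphXn -rmorphMn -rmorphB !simil_discr /=.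
by rewrite !simil_det.
Qed.

Record regular_eigenvalues b1 b2 c1 c2 : Prop := RegularEigenvalues {
  regular_neqb : b1 != b2;
  regular_neqc : c1 != c2;
  regular_discr1 : b1 ^+ 4 - c1 *+ 4 != 0;
  regular_discr2 : b2 ^+ 4 - c2 *+ 4 != 0;
  regular_tr : forall x w, x ^+ 2 + b1 ^+ 2 * x + c1 = 0 ->
    w ^+ 2 + b2 ^+ 2 * w + c2 = 0 -> x + w + b1 * b2 != 0 }.

(** The eigenvalues of [B] are given, not constructed, so that the lemma applies both over the
    algebraic closure and over the smaller field [L]. *)
Lemma diagonalize (B C : 'M[F]_2) b1 b2 :
  comm_mx B C -> degeneracy B C != 0 ->
  \tr B = b1 + b2 -> \det B = b1 * b2 ->
  exists P (uP : P \is a GRing.unit) c1 c2,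
    [/\ simil uP B = mat2 b1 0 0 b2, simil uP C = mat2 c1 0 0 c2 &
        regular_eigenvalues b1 b2 c1 c2].
Proof.
move=> cBC ndeg trB detB.
have [B01 nb] : B 0 1 != 0 /\ b1 != b2.
  move: ndeg; rewrite /degeneracy !mulf_eq0 !negb_or.
  move=> /andP[/andP[/andP[/andP[-> dB _] _] _]].
  split=> //; apply: contra_neq dB => eb.
  by rewrite /discr trB detB eb; ring.
(* [(b - B 1 1, B 0 1)] is a left eigenvector of [B] for the eigenvalue [b]. *)
pose P := mat2 (b1 - B 1 1) (B 0 1) (b2 - B 1 1) (B 0 1).
have uP : P \is a GRing.unit.
  suff : P \in unitmx by [].
  rewrite unitmxE det_mat2 unitfE.
  have -> : (b1 - B 1 1) * B 0 1 - B 0 1 * (b2 - B 1 1) = B 0 1 * (b1 - b2).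
    by ring.
  by rewrite mulf_neq0 // subr_eq0.
have eB : simil uP B = mat2 b1 0 0 b2.
  apply: (mulIr uP); rewrite /simil divrK // [B]mat2_eta /P !mat2E.
  have eb1 : b1 + b2 = B 0 0 + B 1 1 by rewrite -trB {1}[B]mat2_eta tr_mat2.
  have eb2 : b1 * b2 = B 0 0 * B 1 1 - B 0 1 * B 1 0.
    by rewrite -detB {1}[B]mat2_eta det_mat2.
  have {eb1}eb : B 0 0 = b1 + b2 - B 1 1 by rewrite eb1 addrK.
  have {eb2}eb' : B 0 1 * B 1 0 = B 0 0 * B 1 1 - b1 * b2.
    by rewrite eb2 opprB addrCA subrr addr0.
  by congr mat2; rewrite ?eb' ?eb; ring.
have [c1 [c2 eC]] : exists c1 c2, simil uP C = mat2 c1 0 0 c2.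
  have : comm_mx (simil uP C) (simil uP B) by apply/simil_comm/comm_mx_sym.
  rewrite eB [simil uP C]mat2_eta => /(diag_comm _ _ _ _ nb)[-> ->].
  by exists (simil uP C 0 0), (simil uP C 1 1).
exists P, uP, c1, c2; split=> //.
move: ndeg; rewrite (degeneracy_simil uP) eB eC !diag_discr.
have -> : mat2 b1 0 0 b2 ^+ 4 - mat2 c1 0 0 c2 *+ 4 =
          mat2 (b1 ^+ 4 - c1 *+ 4) 0 0 (b2 ^+ 4 - c2 *+ 4).
  by rewrite -[4%N]/(2 * 2)%N !exprM !expr2 !mat2E; congr mat2; ring.
(* One zero off-diagonal entry already makes the determinant the product of the diagonal entries. *)
have res01 : resultant (mat2 b1 0 0 b2) (mat2 c1 0 0 c2) 0 1 = 0.
  by rewrite /resultant diag_shift diag_discr !expr2 !mat2E mxE /=; ring.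
rewrite [resultant _ _]mat2_eta res01 !det_mat2 !mul0r !subr0.
rewrite !mulf_eq0 !negb_or.
move=> /andP[/andP[/andP[_ /andP[nc _]] /andP[d1 d2]] /andP[r1 _]].
split=> //; first by rewrite -subr_eq0.
(* If the trace condition failed, eliminating [w], [c1] and [c2] would put [x] under the hypothesis
   of [diag_resultant], and the first diagonal entry of the resultant would vanish. *)
move=> x w ex ew; apply: contra_neq r1 => tr0.
rewrite (diag_resultant (x := x)) ?ex ?mulr0 //.
have -> : c1 = - (x ^+ 2 + b1 ^+ 2 * x).
  by apply/eqP; rewrite -addr_eq0 addrC ex.
have -> : c2 = - (w ^+ 2 + b2 ^+ 2 * w).
  by apply/eqP; rewrite -addr_eq0 addrC ew.
have -> : w = - (b1 * b2) - x.
  by apply/eqP; rewrite -subr_eq0 -[X in _ == X]tr0; apply/eqP; ring.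
by ring.
Qed.

End Diagonal.

(** * Evaluation of polynomials at a commuting pair, and genericity *)

Section Genericity.
Variables (F : fieldType) (iota : {rmorphism rat -> F}) (n : nat).
Variables B C : 'M[F]_n.

Fact eval_pair_is_zmod_morphism : zmod_morphism (eval_pair iota B C).
Proof. by move=> P Q; rewrite /eval_pair !rmorphB. Qed.

Fact eval_pair_is_monoid_morphism : monoid_morphism (eval_pair iota B C).
Proof. by split=> [|P Q]; rewrite /eval_pair ?rmorph1 ?rmorphM. Qed.

HB.instance Definition _ := GRing.isZmodMorphism.Build
  {mpoly rat[n * n + n * n]} F (eval_pair iota B C) eval_pair_is_zmod_morphism.
HB.instance Definition _ := GRing.isMonoidMorphism.Build
  {mpoly rat[n * n + n * n]} F (eval_pair iota B C)
  eval_pair_is_monoid_morphism.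

Lemma eval_indet_mx0 : map_mx (eval_pair iota B C) (indet_mx0 n) = B.
Proof.
apply/matrixP => i j; rewrite !mxE /eval_pair map_mpolyX mevalXU.
by rewrite row_mxEl mxvecE.
Qed.

Lemma eval_indet_mx1 : map_mx (eval_pair iota B C) (indet_mx1 n) = C.
Proof.
apply/matrixP => i j; rewrite !mxE /eval_pair map_mpolyX mevalXU.
by rewrite row_mxEr mxvecE.
Qed.

Lemma eval_commutation_ideal P :
  comm_mx B C -> commutation_ideal P -> eval_pair iota B C P = 0.
Proof.
move=> cBC [Q ->]; rewrite rmorph_sum big1 // => i _.
rewrite rmorph_sum big1 // => k _; rewrite rmorphM /=.
have -> : eval_pair iota B C
    ((indet_mx0 n *m indet_mx1 n - indet_mx1 n *m indet_mx0 n) i k) =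
  map_mx (eval_pair iota B C)
    (indet_mx0 n *m indet_mx1 n - indet_mx1 n *m indet_mx0 n) i k.
  by rewrite !mxE.
rewrite map_mxB !map_mxM eval_indet_mx0 eval_indet_mx1 cBC subrr.
by rewrite mxE mulr0.
Qed.

End Genericity.

Lemma generic_degeneracy (F : fieldType) (iota : {rmorphism rat -> F})
  (B C : 'M[F]_2) : generic_commuting iota B C -> degeneracy B C != 0.
Proof.
case=> _ gBC.
have := gBC (degeneracy (indet_mx0 2) (indet_mx1 2)).
rewrite -degeneracy_map eval_indet_mx0 eval_indet_mx1; apply=> idl.
(* [C0] is [1 + B0], so the two commute; the eigenvalue pairs are (0, 1) and (1, 2). [B0] is not
   diagonal because [B 0 1] is a factor. The five factors are 1, 1, 1, 28 and 4. *)
pose B0 : 'M[rat]_2 := mat2 0 1 0 1; pose C0 : 'M[rat]_2 := mat2 1 1 0 2.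
have cBC0 : comm_mx B0 C0 by rewrite /comm_mx mulmxE !mat2E; congr mat2.
have := eval_commutation_ideal idfun cBC0 idl.
rewrite -degeneracy_map eval_indet_mx0 eval_indet_mx1.
have -> : degeneracy B0 C0 = 112.
  rewrite /degeneracy /resultant /shift /discr /B0 /C0.
  by rewrite -[4%N]/(2 * 2)%N !exprM !expr2 !mat2E mxE /=; ring.
by move/eqP; rewrite Num.Theory.pnatr_eq0.
Qed.

(** * Quadratics over a closed field, finite counting, and Zariski open sets *)

Lemma closed_quadratic (F : closedFieldType) (s p : F) :
  exists r1 r2, r1 + r2 = s /\ r1 * r2 = p.
Proof.
(* The list holds the coefficients in [r^2 = - p + s r]; the other root is then [s - r]. *)
have [r er] := @solve_monicpoly F 2 (nth 0 [:: - p; s]) isT.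
exists r, (s - r); split; first by rewrite addrC subrK.
move: er; rewrite !big_ord_recl big_ord0 /= expr0 expr1 mulr1 addr0 => er.
by rewrite mulrBr -expr2 er; ring.
Qed.

Lemma closed_quadratic_roots (F : closedFieldType) (a c : F) :
  a ^+ 2 - c *+ 4 != 0 ->
  exists2 r : F * F, r.1 != r.2 &
    forall x, x ^+ 2 + a * x + c = 0 <-> x \in [:: r.1; r.2].
Proof.
have [r1 [r2 [es ep]]] := closed_quadratic (- a) c; move=> nd.
exists (r1, r2) => [|x] /=.
  apply: contra_neq nd => e; rewrite -[a]opprK -es -ep e; ring.
have -> : x ^+ 2 + a * x + c = (x - r1) * (x - r2).
  by rewrite -ep -[a]opprK -es; ring.
rewrite !inE -[x == r1]subr_eq0 -[x == r2]subr_eq0 -mulf_eq0.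
by split=> /eqP.
Qed.

Lemma card_seq (T : choiceType) (s : seq T) :
  uniq s -> [set x | x \in s] #= `I_(size s).
Proof.
case: s => [|x0 s'] us; first by rewrite II0 card_eq0; apply/eqP/seteqP; split.
set s := x0 :: s' in us *.
rewrite card_eq_sym.
have -> : [set x | x \in s] = [set nth x0 s i | i in `I_(size s)].
  apply/seteqP; split=> x /=; first by move=> /(nthP x0)[i ? <-]; exists i.
  by move=> [i ? <-]; apply: mem_nth.
rewrite card_eq_sym; apply: inj_card_eq => i k.
by rewrite !inE => ls lk /eqP; rewrite nth_uniq // => /eqP.
Qed.

Lemma zariski_open_neq0 (F : fieldType) n (p : {mpoly F[n * n]}) :
  zariski_closed (~` [set X : 'M[F]_n | p.@[mxvec X 0] != 0]).
Proof.
exists [set p]; apply/seteqP; split=> X /= => [nX q ->|/(_ p erefl) -> /negP//].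
by apply/eqP/negPn/negP.
Qed.

(** The nonvanishing locus of [p] will serve as the isolating neighborhood: the trace factor
    excludes non-diagonal solutions, the determinant factor the other diagonal ones. *)
Lemma tr_det_poly (F : fieldType) n (a : F) (M : 'M[F]_n) :
  exists p : {mpoly F[n * n]},
    forall X : 'M[F]_n, p.@[mxvec X 0] = (\tr X + a) * \det (X + M).
Proof.
pose U : 'M[{mpoly F[n * n]}]_n := \matrix_(i, k) 'X_(mxvec_index i k).
exists ((\tr U + a%:MP) * \det (U + map_mx (@mpolyC (n * n) F) M)) => X.
have eU : map_mx (meval (mxvec X 0)) U = X.
  by apply/matrixP => i k; rewrite !mxE mevalXU mxvecE.
rewrite rmorphM rmorphD /= -trace_map_mx -det_map_mx map_mxD eU mevalC.
congr (_ * \det (_ + _)); apply/matrixP => i k; rewrite !mxE; exact: mevalC.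
Qed.

(** * The four commuting solutions and their isolation *)

Section TrivialSolutions.
Variables (F : closedFieldType) (B C : 'M[F]_2).
Hypotheses (cBC : comm_mx B C) (ndeg : degeneracy B C != 0).

(** Counting and isolation both start from this reduction to two independent scalar quadratics. *)
Lemma trivial_solutionsP : exists P (uP : P \is a GRing.unit) b1 b2 c1 c2,
  [/\ simil uP B = mat2 b1 0 0 b2, simil uP C = mat2 c1 0 0 c2,
      regular_eigenvalues b1 b2 c1 c2,
      \det B = b1 * b2 &
  forall X, [/\ solutions B C X, comm_mx X B & comm_mx X C] <->
   exists x w, [/\ simil uP X = mat2 x 0 0 w, x ^+ 2 + b1 ^+ 2 * x + c1 = 0 &
     w ^+ 2 + b2 ^+ 2 * w + c2 = 0]].
Proof.
have [b1 [b2 [trB detB]]] := closed_quadratic (\tr B) (\det B).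
have [P [uP [c1 [c2 [eB eC reg]]]]] :=
  diagonalize cBC ndeg (esym trB) (esym detB).
have [nb nc _ _ _] := reg.
exists P, uP, b1, b2, c1, c2; split=> // X; split.
  move=> [/(simil_solutions uP) + /(simil_comm uP) + _].
  rewrite eB eC [simil uP X]mat2_eta => + /(diag_comm _ _ _ _ nb)[y0 z0].
  rewrite y0 z0 => /diag_solutions[e1 _ _ e2].
  exists (simil uP X 0 0), (simil uP X 1 1).
  by split=> //; [rewrite -[RHS]e1 | rewrite -[RHS]e2]; ring.
move=> [x [w [eX ex ew]]].
split; [apply/(simil_solutions uP)|apply/(simil_comm uP)..];
  rewrite ?eB ?eC eX; [|exact/diag_comm..].
by apply/diag_solutions; split; rewrite ?mul0r // addr0.
Qed.

Lemma trivial_solutions_card :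
  [set X | [/\ solutions B C X, comm_mx X B & comm_mx X C]] #= `I_4.
Proof.
have [P [uP [b1 [b2 [c1 [c2 [_ _ [_ _ d1 d2 _] _ trivP]]]]]]] :=
  trivial_solutionsP.
have [|[x1 x2] /= nx xP] := @closed_quadratic_roots F (b1 ^+ 2) c1.
  by rewrite -exprM.
have [|[w1 w2] /= nw wP] := @closed_quadratic_roots F (b2 ^+ 2) c2.
  by rewrite -exprM.
pose s := [seq P^-1 * mat2 x 0 0 w * P | x <- [:: x1; x2], w <- [:: w1; w2]].
have simK X : simil uP (P^-1 * X * P) = X.
  by rewrite /simil !mulrA mulrK // divrr ?mul1r.
suff -> : [set X | [/\ solutions B C X, comm_mx X B & comm_mx X C]] =
          [set X | X \in s].
  apply: (@card_seq _ s); apply: allpairs_uniq; rewrite /= ?inE ?andbT //.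
  move=> [x w] [x' w'] _ _ /(congr1 (simil uP)); rewrite !simK.
  by case/mat2_inj => -> _ _ ->.
apply/seteqP; split=> X /=.
  move/trivP => [x [w [eX /xP xx /wP ww]]]; apply/allpairsP; exists (x, w).
  by split=> //; apply: (@simil_inj _ _ uP); rewrite simK.
move/allpairsP => [[x w] /= [/xP ex /wP ew ->]].
by apply/trivP; exists x, w; split.
Qed.

Lemma trivial_solutions_isolated X :
  solutions B C X -> comm_mx X B -> comm_mx X C -> isolated (solutions B C) X.
Proof.
move=> solX cXB cXC; split=> //.
have [P [uP [b1 [b2 [c1 [c2 [eB eC [nb nc d1 d2 tr0] detB trivP]]]]]]] :=
  trivial_solutionsP.
have /trivP[x [w [eX ex ew]]] := And3 solX cXB cXC.
(* For a solution [Y] diagonal in the eigenbasis, with entries [x'] and [w'],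
   subtracting the equations gives [(x' - x) (x' + x + b1^2) = 0] and its
   analogue for [w'], so [\det (Y + X + B^2) != 0] forces [Y = X]. *)
have [p pE] := tr_det_poly (\det B) (X + B ^+ 2).
pose U := [set Y : 'M[F]_2 | p.@[mxvec Y 0] != 0].
have eXB : simil uP (X + B ^+ 2) = mat2 (x + b1 ^+ 2) 0 0 (w + b2 ^+ 2).
  by rewrite rmorphD rmorphXn /= eX eB expr2 !mat2E; congr mat2; ring.
(* [2 r + a^2] is the derivative of the quadratic at its root [r], and its square is the
   discriminant. This puts [X] itself in [U]. *)
have neq0 (a b r : F) : r ^+ 2 + a ^+ 2 * r + b = 0 -> a ^+ 4 - b *+ 4 != 0 ->
    r + (r + a ^+ 2) != 0.
  move=> er; apply: contra_neq => r0.
  have -> : b = - (r ^+ 2 + a ^+ 2 * r).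
    by apply/eqP; rewrite -addr_eq0 addrC er.
  have ea : a ^+ 2 = - (r *+ 2).
    by apply/eqP; rewrite -subr_eq0 -[X in _ == X]r0; apply/eqP; ring.
  by rewrite -[4%N]/(2 * 2)%N exprM ea; ring.
have UE Y : U Y <->
    (\tr (simil uP Y) + b1 * b2) *
      \det (simil uP Y + mat2 (x + b1 ^+ 2) 0 0 (w + b2 ^+ 2)) != 0.
  by rewrite /U /= pE -detB -eXB -rmorphD simil_tr simil_det.
have UX : U X.
  apply/UE; rewrite eX !mat2E !addr0 mulr0 subr0.
  by rewrite !mulf_neq0 ?tr0 ?(neq0 b1 c1) ?(neq0 b2 c2).
exists U; first by exists U; split=> //; exact: zariski_open_neq0.
apply/seteqP; split=> [Y [/UE UY solY]|_ -> //].
apply: (@simil_inj _ _ uP); rewrite eX.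
move/(simil_solutions uP): solY UY; rewrite eB eC.
rewrite [simil uP Y]mat2_eta.
move: (simil uP Y 0 0) (simil uP Y 0 1) (simil uP Y 1 0) (simil uP Y 1 1).
move=> x' y z w' /diag_solutions[e1 /eqP ey /eqP ez e2].
rewrite !mat2E mulf_eq0 negb_or => /andP[/negPf nt].
move: ey ez; rewrite !mulf_eq0 nt !orbF => /eqP y0 /eqP z0.
rewrite {}y0 {}z0 in e1 e2 *.
rewrite !add0r mul0r subr0 mulf_eq0 negb_or => /andP[nx nw].
congr mat2; apply/eqP; rewrite -subr_eq0.
  rewrite -(mulIr_eq0 _ (mulIf nx)).
  apply/eqP; have := congr2 (fun u v => u - v) e1 ex.
  by rewrite subrr => <-; ring.
rewrite -(mulIr_eq0 _ (mulIf nw)).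
apply/eqP; have := congr2 (fun u v => u - v) e2 ew.
by rewrite subrr => <-; ring.
Qed.

End TrivialSolutions.

(** * Rational functions in one variable and integrality over the constants *)

Section RationalFunctions.
Variable L : fieldType.

Fact ratfun_const_is_zmod_morphism : zmod_morphism (@ratfun_const L).
Proof. by move=> a b; rewrite /ratfun_const !rmorphB. Qed.

Fact ratfun_const_is_monoid_morphism : monoid_morphism (@ratfun_const L).
Proof. by split=> [|a b]; rewrite /ratfun_const ?rmorph1 ?rmorphM. Qed.

HB.instance Definition _ := GRing.isZmodMorphism.Build L (ratfun L)
  (@ratfun_const L) ratfun_const_is_zmod_morphism.
HB.instance Definition _ := GRing.isMonoidMorphism.Build L (ratfun L)
  (@ratfun_const L) ratfun_const_is_monoid_morphism.

Lemma ratfun_fracP (x : ratfun L) :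
  exists p q : {poly L}, [/\ coprimep p q, q != 0 & x * tofrac q = tofrac p].
Proof.
have [p [q [q0 exq]]] :
    exists p q : {poly L}, q != 0 /\ x * tofrac q = tofrac p.
  (* On representatives, equality of fractions is cross-multiplication. *)
  elim/quotW: x => x; exists (frac x).1, (frac x).2.
  split; first exact: denom_ratioP.
  unlock FracField.tofrac; rewrite -[LHS]FracField.pi_mul; apply/eqmodP.
  rewrite /= FracField.equivfE /FracField.mulf.
  have d0 := denom_ratioP x.
  by rewrite !numden_Ratio ?mulf_neq0 ?oner_neq0 // !mulr1 mulrC.
pose g := gcdp p q.
have g0 : g != 0 by rewrite gcdp_eq0 negb_and q0 orbT.
exists (p %/ g), (q %/ g).
have ep : p = p %/ g * g by rewrite divpK // dvdp_gcdl.
have eq : q = q %/ g * g by rewrite divpK // dvdp_gcdr.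
split; first by rewrite coprimep_div_gcd // q0 orbT.
  by apply: contra_neq q0 => e; rewrite eq e mul0r.
apply: (mulIf (x := tofrac g)); first by rewrite tofrac_eq0.
by rewrite -mulrA -!rmorphM /= -eq -ep.
Qed.

(** Rational root argument: in lowest terms [p / q], [q] divides [p^2], hence is a constant [d].
    Then [p (p + a d) = - c d^2], whose left side has twice the degree of [p] if [p] is not
    constant. *)
Lemma ratfun_quadratic_const (a c : L) (x : ratfun L) :
  x ^+ 2 + ratfun_const a * x + ratfun_const c = 0 ->
  exists y, x = ratfun_const y.
Proof.
have [p [q [cpq q0 exq]]] := ratfun_fracP x.
move=> /(congr1 ( *%R^~ (tofrac q ^+ 2))).
have -> : (x ^+ 2 + ratfun_const a * x + ratfun_const c) * tofrac q ^+ 2 =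
  (x * tofrac q) ^+ 2 + ratfun_const a * (x * tofrac q) * tofrac q +
  ratfun_const c * tofrac q ^+ 2.
  by ring.
rewrite exq mul0r /ratfun_const -!rmorphXn -!rmorphM -!rmorphD => /eqP.
rewrite tofrac_eq0 /= => /eqP e.
have : q %| p ^+ 2.
  suff -> : p ^+ 2 = - (a%:P * p + c%:P * q) * q by exact: dvdp_mulIr.
  by apply/eqP; rewrite -subr_eq0 -[X in _ == X]e; apply/eqP; ring.
rewrite expr2 Gauss_dvdpr 1?coprimep_sym // => dqp.
have /eqp_size : q %= 1 by apply: (coprimepP _ _ cpq).
rewrite size_poly1 => /eqP/size_poly1P[d d0 eqd].
have [|em] := leqP (size p) 1.
  move=> /size1_polyC ep; exists (p`_0 / d).
  apply: (mulIf (x := tofrac q)); first by rewrite tofrac_eq0.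
  by rewrite exq ep eqd /ratfun_const -rmorphM -polyCM divfK // coefC.
have sz : size (p + (a * d)%:P) = size p.
  by rewrite size_polyDl // (leq_ltn_trans (size_polyC_leq1 _)).
have : size (p * (p + (a * d)%:P)) = size (- (c * d ^+ 2)%:P).
  congr (size (polyseq _)); apply/eqP.
  rewrite -subr_eq0 -[X in _ == X]e eqd !expr2 !rmorphM.
  by apply/eqP; ring.
rewrite size_mul -?size_poly_gt0 ?sz ?(ltnW em) // size_polyN => es.
have := size_polyC_leq1 (c * d ^+ 2); rewrite -es.
by case: (size p) em => [|[|m]] //; rewrite addSn /= addnS.
Qed.


End RationalFunctions.

(** * The noncommuting solutions over [L(u)] *)

Lemma diag_family (L E : fieldType) (f : {rmorphism L -> E})
    (b1 b2 c1 c2 x w k : L) (u : E) :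
  u != 0 -> x + w + b1 * b2 = 0 ->
  x ^+ 2 + k + b1 ^+ 2 * x + c1 = 0 -> w ^+ 2 + k + b2 ^+ 2 * w + c2 = 0 ->
  solutions (mat2 (f b1) 0 0 (f b2)) (mat2 (f c1) 0 0 (f c2))
            (mat2 (f x) u (f k / u) (f w)).
Proof.
move=> u0 etr /(congr1 f) ex /(congr1 f) ew; apply/diag_solutions.
have ft : f x + f w + f b1 * f b2 = 0 by rewrite -rmorphM -!rmorphD etr rmorph0.
(* The off-diagonal entries multiply to [f k], so [u] disappears from the diagonal equations. *)
rewrite ft !mulr0 [u * _]mulrC divfK //.
by split=> //; [move: ex | move: ew]; rewrite rmorph0 !expr2 !rmorphD !rmorphM.
Qed.

Section ParametricSolutions.
Variables (L : fieldType) (B C : 'M[L]_2) (b1 b2 : L).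
Hypotheses (cBC : comm_mx B C) (ndeg : degeneracy B C != 0).
Hypotheses (trB : \tr B = b1 + b2) (detB : \det B = b1 * b2).

Local Notation const := (@ratfun_const L).
Local Notation Bu := (map_mx const B).
Local Notation Cu := (map_mx const C).

Lemma map_simil (P : 'M[L]_2) (uP : P \is a GRing.unit)
    (uPu : map_mx const P \is a GRing.unit) (X : 'M[L]_2) :
  map_mx const (simil uP X) = simil uPu (map_mx const X).
Proof. by rewrite /simil !rmorphM rmorphV. Qed.

(** The change of basis has entries in [L], so conjugating by it preserves constancy: dependence on
    the parameter can be tested in the eigenbasis. *)
Lemma parametric_diagonalize :
  exists P (uP : P \is a GRing.unit) (uPu : map_mx const P \is a GRing.unit)
    c1 c2,
    [/\ simil uPu Bu = mat2 (const b1) 0 0 (const b2),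
        simil uPu Cu = mat2 (const c1) 0 0 (const c2),
        b1 != b2 & c1 != c2].
Proof.
have [P [uP [c1 [c2 [eB eC [nb nc _ _ _]]]]]] :=
  diagonalize cBC ndeg trB detB.
have uPu : map_mx const P \is a GRing.unit by apply: rmorph_unit.
exists P, uP, uPu, c1, c2; split=> //.
  by rewrite -(map_simil uP) eB map_mat2 rmorph0.
by rewrite -(map_simil uP) eC map_mat2 rmorph0.
Qed.

Lemma parametric_not_comm X : solutions Bu Cu X -> depends_on_param X ->
  ~ comm_mx X Bu /\ ~ comm_mx X Cu.
Proof.
have [P [uP [uPu [c1 [c2 [eB eC nb nc]]]]]] := parametric_diagonalize.
move=> + depX; move=> /(simil_solutions uPu); rewrite eB eC => solX.
(* As [b1 != b2] and [c1 != c2], commuting with either matrix would kill both off-diagonal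
   entries. *)
suff offdiag : ~ (simil uPu X 0 1 = 0 /\ simil uPu X 1 0 = 0).
  split=> /(simil_comm uPu); rewrite ?eB ?eC [simil uPu X]mat2_eta;
    by move/diag_comm => /(_ _)/offdiag; apply; rewrite fmorph_eq.
move=> [y0 z0]; apply: depX.
move: solX; rewrite [simil uPu X]mat2_eta y0 z0 => /diag_solutions[ex _ _ ew].
rewrite mul0r !addr0 -!rmorphXn in ex ew.
have [x ex'] := ratfun_quadratic_const ex.
have [w ew'] := ratfun_quadratic_const ew.
have [Y eY] := simil_surj uP (mat2 x 0 0 w).
exists Y; apply: (@simil_inj _ _ uPu).
rewrite -(map_simil uP) eY map_mat2 rmorph0.
by rewrite [LHS]mat2_eta y0 z0 ex' ew'.
Qed.

Lemma parametric_infinite :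
  infinite_set [set X | solutions Bu Cu X /\ depends_on_param X].
Proof.
have [P [uP [uPu [c1 [c2 [eB eC nb nc]]]]]] := parametric_diagonalize.
(* With [w = - b1 b2 - x], equating the two diagonal equations cancels [x^2] and leaves a linear
   equation for [x]; [k] is the resulting value of [y z]. *)
pose x := (b1 * b2 ^+ 2 * (b1 - b2) - (c1 - c2)) / (b1 - b2) ^+ 2.
pose w := - (b1 * b2) - x.
pose k := - (x ^+ 2 + b1 ^+ 2 * x + c1).
have ek : - (w ^+ 2 + b2 ^+ 2 * w + c2) = k.
  by rewrite /k /w /x; field; rewrite subr_eq0.
(* Powers of the variable give infinitely many values of the free entry; the exponent starts at 1 so
   that none is constant. *)
pose u n : ratfun L := tofrac ('X^(n.+1) : {poly L}).
have u0 n : u n != 0 by rewrite tofrac_eq0 expf_neq0 // polyX_eq0.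
pose D n := mat2 (const x) (u n) (const k / u n) (const w).
have /choice[X eX] := fun n => simil_surj uPu (D n).
have X_inj : injective X.
  move=> m n /(congr1 (simil uPu)); rewrite !eX => /mat2_inj[_ + _ _].
  move/eqP; rewrite tofrac_eq => /eqP/(congr1 (size \o val)) /=.
  by rewrite !size_polyXn => -[].
apply: (@sub_infinite_set _ (range X)) => [_ [n _ <-]|]; last first.
  rewrite (eq_finite_set (inj_card_eq _)); first exact: infinite_nat.
  by move=> m n _ _; apply: X_inj.
split.
  apply/(simil_solutions uPu).
  rewrite eB eC eX.
  apply: (@diag_family _ _ (@ratfun_const L) _ _ _ _ x w k (u n)).
  - exact: u0.
  - by rewrite /w addrCA subrr addr0 addNr.
  - by rewrite /k; ring.
  - by rewrite -ek; ring.
move=> [Y eY].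
have := eX n; rewrite eY -(map_simil uP) [simil uP Y]mat2_eta map_mat2.
move/mat2_inj => [_ + _ _]; move/eqP.
rewrite tofrac_eq => /eqP/(congr1 (size \o val)) /=.
rewrite size_polyXn => e.
by have := size_polyC_leq1 (simil uP Y 0 1); rewrite e.
Qed.

End ParametricSolutions.

(** * Eigenvalues, and transfer between the fields of the theorem *)

Lemma eigenvalue_det (F : fieldType) n (A : 'M[F]_n) a :
  eigenvalue A a = (\det (A - a%:M) == 0).
Proof.
by rewrite /eigenvalue kermx_eq0 row_free_unit unitmxE unitfE negbK.
Qed.

Lemma eigenvalue_mat2 (F : fieldType) (A : 'M[F]_2) a b :
  a + b = \tr A -> a * b = \det A -> eigenvalue A a.
Proof.
rewrite eigenvalue_det [A]mat2_eta !mat2E => e1 e2; apply/eqP.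
move: (A 0 0) (A 0 1) (A 1 0) (A 1 1) e1 e2 => x y z w e1 e2.
have -> : (x - a) * (w - a) - (y - 0) * (z - 0) =
          (x * w - y * z) - a * (x + w) + a * a by ring.
by rewrite -e1 -e2; ring.
Qed.

Theorem proposition5
    (F : fieldType) (iota : {rmorphism rat -> F})
    (F_transcendental : transcendental_ext iota)
    (B C : 'M[F]_2) (BC_generic : generic_commuting iota B C)
    (K := entry_field iota B C)
    (BK := entry_mxl iota B C : 'M[K]_2) (CK := entry_mxr iota B C : 'M[K]_2)
    (Kbar : closedFieldType) (j : {rmorphism K -> Kbar})
    (Kbar_closure : is_algebraic_closure j)
    (Bbar := map_mx j BK : 'M[Kbar]_2) (Cbar := map_mx j CK : 'M[Kbar]_2)
    (L := spectral_field j BK CK)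
    (toLu := fun a : K => ratfun_const (adjoin_base j (spectra j BK CK) a))
    (Bu := map_mx toLu BK : 'M[ratfun L]_2)
    (Cu := map_mx toLu CK : 'M[ratfun L]_2)
    (trivial_solutions := [set X : 'M[Kbar]_2 |
       [/\ solutions Bbar Cbar X, comm_mx X Bbar & comm_mx X Cbar]])
    (parametric_solutions := [set X : 'M[ratfun L]_2 |
       solutions Bu Cu X /\ depends_on_param X]) :
  (trivial_solutions #= `I_4 /\
   forall X, trivial_solutions X -> isolated (solutions Bbar Cbar) X) /\
  (infinite_set parametric_solutions /\
   forall X, parametric_solutions X -> ~ comm_mx X Bu /\ ~ comm_mx X Cu).
Proof.
have map_comm (E : fieldType) (f : {rmorphism K -> E}) :
    comm_mx BK CK -> comm_mx (map_mx f BK) (map_mx f CK).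
  by rewrite /comm_mx -!map_mxM => ->.
have cK : comm_mx BK CK.
  apply: (@map_mx_inj _ _ (val : {rmorphism K -> F})).
  by rewrite !map_mxM entry_mxlE entry_mxrE; case: BC_generic.
(* Genericity speaks of [F]; nonvanishing descends to [K] inside [F], then passes to [Kbar] and [L],
   since field morphisms are injective. *)
have dK : degeneracy BK CK != 0.
  rewrite -(fmorph_eq0 (val : {rmorphism K -> F})) -degeneracy_map.
  by rewrite entry_mxlE entry_mxrE (generic_degeneracy BC_generic).
have cbar : comm_mx Bbar Cbar by apply: map_comm.
have dbar : degeneracy Bbar Cbar != 0 by rewrite degeneracy_map fmorph_eq0.
split.
  split; first exact: trivial_solutions_card.
  by move=> X [solX cXB cXC]; apply: trivial_solutions_isolated.
pose toL : {rmorphism K -> L} := adjoin_base j (spectra j BK CK).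
(* The eigenvalues of [B] are found in [Kbar] and lie in [L] by its definition; the identities for
   trace and determinant over [L] are then checked in [Kbar]. *)
have [r1 [r2 [trr detr]]] := closed_quadratic (\tr Bbar) (\det Bbar).
have s1 : spectra j BK CK r1 by left; apply: (eigenvalue_mat2 trr).
have s2 : spectra j BK CK r2.
  by left; apply: (@eigenvalue_mat2 _ _ _ r1); rewrite 1?addrC 1?mulrC.
pose b1 : L := adjoin_gen j s1; pose b2 : L := adjoin_gen j s2.
have trL : \tr (map_mx toL BK) = b1 + b2.
  by rewrite trace_map_mx; apply: val_inj; rewrite rmorphD /= trr trace_map_mx.
have detL : \det (map_mx toL BK) = b1 * b2.
  by rewrite det_map_mx; apply: val_inj; rewrite rmorphM /= detr det_map_mx.
have cL : comm_mx (map_mx toL BK) (map_mx toL CK) by apply: map_comm.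
have dL : degeneracy (map_mx toL BK) (map_mx toL CK) != 0.
  by rewrite degeneracy_map fmorph_eq0.
have eBu : Bu = map_mx (@ratfun_const L) (map_mx toL BK).
  by rewrite -map_mx_comp.
have eCu : Cu = map_mx (@ratfun_const L) (map_mx toL CK).
  by rewrite -map_mx_comp.
rewrite /parametric_solutions eBu eCu.
split; first exact: (parametric_infinite cL dL trL detL).
by move=> X [solX depX]; apply: (parametric_not_comm cL dL trL detL).
Qed.
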